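(* (Internal completeness, negative case) Let $\alpha=(z_1,\dots,z_n,\alpha_0)$ be a logical connective, $\mathbf{P}_1,\dots,\mathbf{P}_n$ positive behaviours, and $N=\sum a(\vec x).P_a$ an atomic negative design. Then $N\in\alpha(\mathbf{P}_1,\dots,\mathbf{P}_n)$ if and only if for every $a(\vec x)\in\alpha_0$, writing $\vec x=z_{i_1},\dots,z_{i_m}$, we have $P_a\models z_{i_1}:\mathbf{P}_{i_1},\dots,z_{i_m}:\mathbf{P}_{i_m}$.
   Context: Fix a signature (names $A$ with arities $\mathsf{ar}$) and a countable set of variables. Designs are possibly infinite terms coinductively generated by: positive $P ::= \Omega \mid \bigwedge\{S_i : i\in I\}$ ($I$ arbitrary); predesigns $S ::= N_0\,|\,\overline{a}\langle N_1,\dots,N_n\rangle$ ($\mathsf{ar}(a)=n$); negative $N ::= x \mid \sum a(\vec x).P_a$ (one component $a(\vec x).P_a$ for each $a\in A$, $\vec x$ distinct bound variables of length $\mathsf{ar}(a)$); up to $\alpha$-renaming and set-like treatment of conjunctions, $\bigwedge\{S\}=S$, $\maltese:=\bigwedge\emptyset$. Reduction: $P\rightsquigarrow Q$ iff $P$ has a conjunct $(\sum a(\vec x).P_a)\,|\,\overline b\langle\vec N\rangle$ and $Q=P_b[\vec N/\vec x]$. Normal form (corecursive): $[\![P]\!]=\Omega$ if some reduction sequence from $P$ is infinite or ends in $\Omega$; otherwise $[\![P]\!]$ is the conjunction of all $x\,|\,\overline a\langle[\![\vec N]\!]\rangle$ with $x|\overline a\langle\vec N\rangle$ a conjunct of some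 $Q$, $P\rightsquigarrow^*Q$; $[\![\sum a(\vec x).P_a]\!]=\sum a(\vec x).[\![P_a]\!]$, $[\![x]\!]=x$. Standard design: $\neq\Omega$ and generated by $P::=\Omega\mid\bigwedge\{S_i\}$, $S::=x\,|\,\overline a\langle N_1,\dots,N_n\rangle$, $N::=\sum a(\vec x).P_a$. Atomic positive: standard with free variables among a fixed variable $x_0$; atomic negative: standard and closed. $P\perp N$ iff $[\![P[N/x_0]]\!]=\maltese$; $\mathbf{X}^\perp$ = atomic designs of opposite polarity orthogonal to every element of $\mathbf{X}$; a behaviour is a set $\mathbf{X}$ of atomic designs of one polarity with $\mathbf{X}^{\perp\perp}=\mathbf{X}$. For a positive context $y_1:\mathbf{Q}_1,\dots,y_k:\mathbf{Q}_k$ (distinct variables, positive behaviours), $P\models y_1:\mathbf{Q}_1,\dots,y_k:\mathbf{Q}_k$ means $P$ is standard, $\mathsf{fv}(P)\subseteq\{y_1,\dots,y_k\}$, and $[\![P[K_1/y_1,\dots,K_k/y_k]]\!]=\maltese$ for all $K_j\in\mathbf{Q}_j^\perp$. An $n$-ary logical connective is $\alpha=(z_1,\dots,z_n,\alpha_0)$ with $z_i$ distinct variables and $\alpha_0$ a finite set of negative actions $a(\vec x)$ ($a\in A$, $\vec x$ a list of $\mathsf{ar}(a)$ distinct variables among $z_1,\dots,z_n$) with pairwise distinct names. For negative behaviours, $\overline a\langle\mathbf N_1,\dots,\mathbf N_m\rangle:=\{x_0\,|\,\overline a\langle N_1,\dots,N_m\rangle : N_j\in\mathbf N_j\}$, $\overline\alpha\langle\mathbf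 N_1,\dots,\mathbf N_n\rangle:=\big(\bigcup_{a(\vec x)\in\alpha_0}\overline a\langle\mathbf N_{i_1},\dots,\mathbf N_{i_m}\rangle\big)^{\perp\perp}$ where $\vec x=z_{i_1},\dots,z_{i_m}$, and for positive behaviours $\alpha(\mathbf P_1,\dots,\mathbf P_n):=\overline\alpha\langle\mathbf P_1^\perp,\dots,\mathbf P_n^\perp\rangle^\perp$. *)

(* Defs.v *)
From Stdlib Require Import ClassicalEpsilon.
From Stdlib Require List.
From mathcomp Require Import all_boot.

Set Implicit Arguments.
Unset Strict Implicit.
Unset Printing Implicit Defensive.

Record signature := Signature { name : Type; ar : name -> nat }.

Notation var := nat (only parsing).

(** Designs are possibly infinite terms, so their syntax is coinductive.
    Alpha-equivalence is handled by de Bruijn indices: in [Sum B], component [a]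
    is [B a], where the indices [0, ..., ar a - 1] are the bound variables and
    [k + ar a] stands for the variable [k] of the surrounding term.  At top level
    an index is the name of a free variable. *)
CoInductive positive (Sg : signature) : Type :=
| Omega
| Conj (I : Type) (F : I -> predesign Sg)
with predesign (Sg : signature) : Type :=
| Cut (N0 : negative Sg) (a : name Sg) (N : 'I_(ar a) -> negative Sg)
with negative (Sg : signature) : Type :=
| Var (x : var)
| Sum (B : forall a : name Sg, positive Sg).

Arguments Omega {Sg}.
Arguments Conj {Sg I} F.
Arguments Cut {Sg} N0 a N.
Arguments Var {Sg} x.
Arguments Sum {Sg} B.

(** Equality of designs: conjunctions are compared as sets of conjuncts. *)
CoInductive eq_pos (Sg : signature) : positive Sg -> positive Sg -> Prop :=
| eq_pos_Omega : eq_pos Omega Omega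
| eq_pos_Conj (I J : Type) (F : I -> predesign Sg) (G : J -> predesign Sg) :
    (forall i, exists j, eq_pre (F i) (G j)) ->
    (forall j, exists i, eq_pre (F i) (G j)) -> eq_pos (Conj F) (Conj G)
with eq_pre (Sg : signature) : predesign Sg -> predesign Sg -> Prop :=
| eq_pre_Cut (N0 N0' : negative Sg) (a : name Sg)
    (N N' : 'I_(ar a) -> negative Sg) :
    eq_neg N0 N0' -> (forall j, eq_neg (N j) (N' j)) ->
    eq_pre (Cut N0 a N) (Cut N0' a N')
with eq_neg (Sg : signature) : negative Sg -> negative Sg -> Prop :=
| eq_neg_Var (x : var) : eq_neg (Var x) (Var x)
| eq_neg_Sum (B B' : name Sg -> positive Sg) :
    (forall a, eq_pos (B a) (B' a)) -> eq_neg (Sum B) (Sum B').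

Section Designs.
Variable Sg : signature.
Notation positive := (positive Sg).
Notation predesign := (predesign Sg).
Notation negative := (negative Sg).

Definition daimon : positive := Conj (of_void predesign).

Definition of_predesign (S : predesign) : positive := Conj (fun _ : unit => S).

(** ** Substitution *)

Definition up_ren (n : nat) (r : var -> var) (k : var) : var :=
  if k < n then k else r (k - n) + n.

CoFixpoint ren_p (r : var -> var) (P : positive) : positive :=
  match P with
  | Omega => Omega
  | Conj J F => Conj (fun i => ren_s r (F i))
  end
with ren_s (r : var -> var) (S : predesign) : predesign :=
  match S with Cut N0 a N => Cut (ren_n r N0) a (fun j => ren_n r (N j)) end
with ren_n (r : var -> var) (N : negative) : negative :=
  match N with
  | Var x => Var (r x)
  | Sum B => Sum (fun a => ren_p (up_ren (ar a) r) (B a))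
  end.

Definition up (n : nat) (s : var -> negative) (k : var) : negative :=
  if k < n then Var k else ren_n (addn^~ n) (s (k - n)).

CoFixpoint subst_p (s : var -> negative) (P : positive) : positive :=
  match P with
  | Omega => Omega
  | Conj J F => Conj (fun i => subst_s s (F i))
  end
with subst_s (s : var -> negative) (S : predesign) : predesign :=
  match S with Cut N0 a N => Cut (subst_n s N0) a (fun j => subst_n s (N j)) end
with subst_n (s : var -> negative) (N : negative) : negative :=
  match N with
  | Var x => s x
  | Sum B => Sum (fun a => subst_p (up (ar a) s) (B a))
  end.

(** [[K_1/y_1, ..., K_k/y_k]], for named variables [y]. *)
Definition named_subst (k : nat) (y : k.-tuple var) (K : 'I_k -> negative)
    (x : var) : negative :=
  if [pick j | tnth y j == x] is Some j then K j else Var x.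

(** Instantiates the [m] variables of a binder, removing that binder. *)
Definition bound_subst (m : nat) (K : 'I_m -> negative) (k : var) : negative :=
  if insub k is Some j then K j else Var (k - m).

(** [P_a] when the binder [a(x)] is written with the names [x]. *)
Definition body_with (a : name Sg) (x : (ar a).-tuple var) (P : positive) :
    positive :=
  subst_p (bound_subst (fun j => Var (tnth x j))) P.

(** ** Free variables, standard and atomic designs *)

Inductive fv_p : var -> positive -> Prop :=
| fv_Conj (x : var) (I : Type) (F : I -> predesign) (i : I) :
    fv_s x (F i) -> fv_p x (Conj F)
with fv_s : var -> predesign -> Prop :=
| fv_head (x : var) (N0 : negative) (a : name Sg) (N : 'I_(ar a) -> negative) :
    fv_n x N0 -> fv_s x (Cut N0 a N)
| fv_arg (x : var) (N0 : negative) (a : name Sg) (N : 'I_(ar a) -> negative)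
    (j : 'I_(ar a)) : fv_n x (N j) -> fv_s x (Cut N0 a N)
with fv_n : var -> negative -> Prop :=
| fv_Var (x : var) : fv_n x (Var x)
| fv_Sum (x : var) (B : name Sg -> positive) (a : name Sg) :
    fv_p (x + ar a) (B a) -> fv_n x (Sum B).

CoInductive std_p : positive -> Prop :=
| std_Omega : std_p Omega
| std_Conj (I : Type) (F : I -> predesign) :
    (forall i, std_s (F i)) -> std_p (Conj F)
with std_s : predesign -> Prop :=
| std_Cut (x : var) (a : name Sg) (N : 'I_(ar a) -> negative) :
    (forall j, std_n (N j)) -> std_s (Cut (Var x) a N)
with std_n : negative -> Prop :=
| std_Sum (B : name Sg -> positive) : (forall a, std_p (B a)) -> std_n (Sum B).

Definition standard_p (P : positive) : Prop := P <> Omega /\ std_p P.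

Definition standard_n (N : negative) : Prop := std_n N.

Definition x0 : var := 0.

Definition atomic_p (P : positive) : Prop :=
  standard_p P /\ forall x, fv_p x P -> x = x0.

Definition atomic_n (N : negative) : Prop :=
  standard_n N /\ forall x, ~ fv_n x N.

(** ** Reduction and normal forms *)

Definition idx (P : positive) : Type :=
  match P with Omega => void | Conj J _ => J end.

Definition conjunct (P : positive) : idx P -> predesign :=
  match P with Omega => of_void predesign | Conj J F => F end.

Definition is_redex (S : predesign) : bool :=
  match S with
  | Cut (Sum _) _ _ => true
  | Cut (Var _) _ _ => false
  end.

(** Only meaningful on redexes. *)
Definition contractum (S : predesign) : positive :=
  match S with
  | Cut (Sum B) b N => subst_p (bound_subst N) (B b)
  | Cut (Var _) _ _ => Omega
  end.

Definition red (P Q : positive) : Prop :=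
  exists i : idx P, is_redex (conjunct i) /\ Q = contractum (conjunct i).

Inductive reds : positive -> positive -> Prop :=
| reds_refl (P : positive) : reds P P
| reds_step (P Q R : positive) : red P Q -> reds Q R -> reds P R.

Definition undefined (P : positive) : Prop :=
  (exists f : nat -> positive, f 0 = P /\ forall n, red (f n) (f n.+1))
  \/ reds P Omega.

(** The non-redex conjuncts of the reducts of [P] cannot be collected as a
    subtype of [predesign], whose universe is too large to index a [Conj]; they
    are indexed instead by the reduction paths leading to them (see
    [end_conjunctP]). *)
Inductive path_to_head (P : positive) : Type :=
| Stop (i : idx P) of ~~ is_redex (conjunct i)
| Step (i : idx P) of is_redex (conjunct i)
    & path_to_head (contractum (conjunct i)).

Fixpoint end_conjunct (P : positive) (t : path_to_head P) : predesign :=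
  match t with
  | Stop i _ => conjunct i
  | Step i _ t' => end_conjunct t'
  end.

Lemma end_conjunctP (P : positive) (S : predesign) :
  (exists t : path_to_head P, end_conjunct t = S) <->
  (exists Q, reds P Q /\
     exists i : idx Q, conjunct i = S /\ exists x a N, S = Cut (Var x) a N).
Proof.
split=> [[t <-]|[Q [PQ [i [iS [x [a [N eS]]]]]]]].
  elim: t => {P}[P i nr|P i r t [Q [PQ H]]].
    exists P; split; first exact: reds_refl.
    exists i; split=> //=; move: nr.
    by case: (conjunct i) => -[x|B] a N // _; exists x, a, N.
  by exists Q; split=> //; apply: reds_step PQ; exists i.
elim: PQ i iS => {P Q}[P|P Q R [k [rk ->]] _ IH] i iS.
  have nr : ~~ is_redex (conjunct i) by rewrite iS eS.
  by exists (Stop nr).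
have [t <-] := IH i iS.
by exists (Step rk t).
Qed.

(** The head of an [end_conjunct] is a variable, which [nf_n] fixes. *)
CoFixpoint nf_p (P : positive) : positive :=
  if excluded_middle_informative (undefined P) then Omega
  else Conj (fun t : path_to_head P => nf_s (end_conjunct t))
with nf_s (S : predesign) : predesign :=
  match S with Cut N0 a N => Cut (nf_n N0) a (fun j => nf_n (N j)) end
with nf_n (N : negative) : negative :=
  match N with
  | Var x => Var x
  | Sum B => Sum (fun a => nf_p (B a))
  end.

(** ** Orthogonality and behaviours *)

Definition orth (P : positive) (N : negative) : Prop :=
  eq_pos (nf_p (subst_p (named_subst [tuple x0] (fun=> N)) P)) daimon.

Definition dual_p (X : positive -> Prop) (N : negative) : Prop :=
  atomic_n N /\ forall P, X P -> orth P N.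

Definition dual_n (Y : negative -> Prop) (P : positive) : Prop :=
  atomic_p P /\ forall N, Y N -> orth P N.

(** Since [orth] respects [eq_pos] and [eq_neg], behaviours are closed under
    equality of designs. *)
Definition positive_behaviour (X : positive -> Prop) : Prop :=
  forall P, dual_n (dual_p X) P <-> X P.

(** [P |= y_1 : Q_1, ..., y_k : Q_k], for distinct [y_j]. *)
Definition models (P : positive) (k : nat) (y : k.-tuple var)
    (Q : 'I_k -> positive -> Prop) : Prop :=
  [/\ standard_p P,
      forall x, fv_p x P -> x \in y
    & forall K : 'I_k -> negative, (forall j, dual_p (Q j) (K j)) ->
        eq_pos (nf_p (subst_p (named_subst y K) P)) daimon].

(** ** Logical connectives *)

Record action := Action { aname : name Sg; avars : (ar aname).-tuple var }.

Record connective (n : nat) := Connective {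
  cvars : n.-tuple var;
  cacts : seq action;
  cvars_uniq : uniq cvars;
  cacts_names : List.NoDup [seq aname s | s <- cacts];
  avars_uniq : forall s, List.In s cacts -> uniq (avars s);
  avars_sub : forall s, List.In s cacts -> {subset avars s <= cvars} }.

(** [x = z_{i_1}, ..., z_{i_m}]. *)
Definition indexed_by (n m : nat) (z : n.-tuple var) (x : m.-tuple var)
    (i : 'I_m -> 'I_n) : Prop :=
  forall j, tnth x j = tnth z (i j).

Definition action_set (a : name Sg) (Ns : 'I_(ar a) -> negative -> Prop)
    (P : positive) : Prop :=
  exists2 N : 'I_(ar a) -> negative, (forall j, Ns j (N j))
    & eq_pos P (of_predesign (Cut (Var x0) a N)).

Definition connective_pos (n : nat) (alpha : connective n)
    (Ns : 'I_n -> negative -> Prop) : positive -> Prop :=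
  dual_n (dual_p (fun P =>
    exists2 s, List.In s (cacts alpha)
      & exists2 i, indexed_by (cvars alpha) (avars s) i
          & action_set (fun j => Ns (i j)) P)).

Definition connective_neg (n : nat) (alpha : connective n)
    (Ps : 'I_n -> positive -> Prop) : negative -> Prop :=
  dual_p (connective_pos alpha (fun i => dual_p (Ps i))).

End Designs.

(* Main.v *)
Require Import Defs.
From Stdlib Require Import Classical ClassicalEpsilon.
From Stdlib Require List.
From mathcomp Require Import all_boot.

(** A design has normal form [daimon] exactly when it lies in the least set
    [converges] of designs [<> Omega] all of whose conjuncts are redexes with
    contractum in the set; this predicate is visibly invariant under equality of
    designs.  Since generators of the connective are atomic, a triple dual reduces
    membership to orthogonality against the generators [x0 | a<K_1, ..., K_m>].
    Substituting [N] for [x0] there produces a single redex whose contractum is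
    [P_a[K/x]] (the [K_j] are closed), which is the design tested by [models].
    The requirement [P_a <> Omega] comes from testing against the negative
    daimon, which belongs to the dual of every positive behaviour. *)

Set Implicit Arguments.
Unset Strict Implicit.
Unset Printing Implicit Defensive.

Scheme fv_p_mut := Minimality for fv_p Sort Prop
  with fv_s_mut := Minimality for fv_s Sort Prop
  with fv_n_mut := Minimality for fv_n Sort Prop.
Combined Scheme fv_mut from fv_p_mut, fv_s_mut, fv_n_mut.

Section Theory.
Variable Sg : signature.
Notation positive := (positive Sg).
Notation predesign := (predesign Sg).
Notation negative := (negative Sg).
Implicit Types (P Q : positive) (S : predesign) (N : negative).
Implicit Types (r : nat -> nat) (s t u : nat -> negative).

(** * One-step unfolding of the corecursive operations *)

Definition force_p P : positive :=
  match P with Omega => Omega | Conj J F => Conj F end.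
Definition force_s S : predesign := match S with Cut N a Ns => Cut N a Ns end.
Definition force_n N : negative :=
  match N with Var x => Var x | Sum B => Sum B end.

(** Rewriting with it puts a cofixpoint under a match, where it unfolds by one step. *)
Lemma force_pE P : P = force_p P. Proof. by case: P. Qed.
Lemma force_sE S : S = force_s S. Proof. by case: S. Qed.
Lemma force_nE N : N = force_n N. Proof. by case: N. Qed.

Lemma ren_pE r P : ren_p r P =
  if P is Conj J F then Conj (fun i => ren_s r (F i)) else Omega.
Proof. by rewrite [LHS]force_pE; case: P. Qed.

Lemma ren_sE r S : ren_s r S =
  let: Cut N a Ns := S in Cut (ren_n r N) a (fun j => ren_n r (Ns j)).
Proof. by rewrite [LHS]force_sE; case: S. Qed.

Lemma ren_nE r N : ren_n r N =
  match N with
  | Var x => Var (r x)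
  | Sum B => Sum (fun a => ren_p (up_ren (ar a) r) (B a))
  end.
Proof. by rewrite [LHS]force_nE; case: N. Qed.

Lemma subst_pE s P : subst_p s P =
  if P is Conj J F then Conj (fun i => subst_s s (F i)) else Omega.
Proof. by rewrite [LHS]force_pE; case: P. Qed.

Lemma subst_sE s S : subst_s s S =
  let: Cut N a Ns := S in Cut (subst_n s N) a (fun j => subst_n s (Ns j)).
Proof. by rewrite [LHS]force_sE; case: S. Qed.

Lemma subst_nE s N : subst_n s N =
  match N with
  | Var x => s x
  | Sum B => Sum (fun a => subst_p (up (ar a) s) (B a))
  end.
Proof. by rewrite [LHS]force_nE; case: N => //= x; case: (s x). Qed.

Lemma subst_of_predesign s S :
  subst_p s (of_predesign S) = of_predesign (subst_s s S).
Proof. by rewrite subst_pE. Qed.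

Lemma nf_pE P : nf_p P =
  if excluded_middle_informative (undefined P) then Omega
  else Conj (fun h : path_to_head P => nf_s (end_conjunct h)).
Proof. by rewrite [LHS]force_pE /=; case: (excluded_middle_informative _). Qed.

(** * Equality of designs and its compatibility with substitution *)

Lemma eq_pos_refl P : eq_pos P P
with eq_pre_refl S : eq_pre S S
with eq_neg_refl N : eq_neg N N.
Proof.
- by case: P => [|J F]; constructor=> i; exists i.
- by case: S => N a Ns; constructor.
- by case: N => [x|B]; constructor.
Qed.

Lemma eq_pos_sym P Q : eq_pos P Q -> eq_pos Q P
with eq_pre_sym S S' : eq_pre S S' -> eq_pre S' S
with eq_neg_sym N N' : eq_neg N N' -> eq_neg N' N.
Proof.
- case=> [|I J F G FG GF]; constructor=> i.
    by case: (GF i) => j e; exists j; apply: eq_pre_sym.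
  by case: (FG i) => j e; exists j; apply: eq_pre_sym.
- by case=> N0 N0' a Ns Ns' eN eNs; constructor=> [|j]; apply: eq_neg_sym.
- case=> [x|B B' eB]; constructor=> a; exact: eq_pos_sym.
Qed.

Lemma eq_ren_p r P Q : eq_pos P Q -> eq_pos (ren_p r P) (ren_p r Q)
with eq_ren_s r S S' : eq_pre S S' -> eq_pre (ren_s r S) (ren_s r S')
with eq_ren_n r N N' : eq_neg N N' -> eq_neg (ren_n r N) (ren_n r N').
Proof.
- case=> [|I J F G FG GF]; rewrite !ren_pE; constructor=> i.
    by case: (FG i) => j e; exists j; apply: eq_ren_s.
  by case: (GF i) => j e; exists j; apply: eq_ren_s.
- case=> N0 N0' a Ns Ns' eN eNs; rewrite !ren_sE.
  by constructor=> [|j]; apply: eq_ren_n.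
- case=> [x|B B' eB]; rewrite !ren_nE; constructor=> a; exact: eq_ren_p.
Qed.

(** [p] stands for being free outside the binder: an index [k >= n] is seen there as [k - n], while
    below [n] both sides are [Var k]. *)
Lemma eq_up n s s' (p : nat -> Prop) :
  (forall k, p k -> eq_neg (s k) (s' k)) ->
  forall k, (n <= k -> p (k - n)) -> eq_neg (up n s k) (up n s' k).
Proof.
rewrite /up => es k pk; case: ltnP => nk; first exact: eq_neg_refl.
by apply/eq_ren_n/es/pk.
Qed.

Lemma fv_SumB (B : name Sg -> positive) a k :
  fv_p k (B a) -> ar a <= k -> fv_n (k - ar a) (Sum B).
Proof. by move=> fk ak; apply: (@fv_Sum _ _ _ a); rewrite subnK. Qed.

Lemma eq_subst_p s s' P Q : eq_pos P Q ->
  (forall k, fv_p k P -> eq_neg (s k) (s' k)) ->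
  eq_pos (subst_p s P) (subst_p s' Q)
with eq_subst_s s s' S S' : eq_pre S S' ->
  (forall k, fv_s k S -> eq_neg (s k) (s' k)) ->
  eq_pre (subst_s s S) (subst_s s' S')
with eq_subst_n s s' N N' : eq_neg N N' ->
  (forall k, fv_n k N -> eq_neg (s k) (s' k)) ->
  eq_neg (subst_n s N) (subst_n s' N').
Proof.
- case=> [|I J F G FG GF] es; rewrite !subst_pE; constructor=> i.
    case: (FG i) => j e; exists j; apply: (eq_subst_s _ _ _ _ e) => k fk.
    by apply: es; apply: fv_Conj fk.
  case: (GF i) => j e; exists j; apply: (eq_subst_s _ _ _ _ e) => k fk.
  by apply: es; apply: fv_Conj fk.
- case=> N0 N0' a Ns Ns' eN eNs es; rewrite !subst_sE.
  constructor=> [|j]; apply: eq_subst_n => // k fk; apply: es.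
    exact: fv_head.
  by apply: (@fv_arg _ _ _ _ _ j).
- case=> [x|B B' eB] es; rewrite !subst_nE.
    by apply: es; constructor.
  constructor=> a; apply: eq_subst_p => // k fk.
  by apply: eq_up es _ _ => ak; apply: fv_SumB.
Qed.

(** Composition law for an inner substitution that is a renaming on the free variables. Under a
    binder it then merely shifts [y], so no commutation of renaming with substitution has to be
    proved. *)
Lemma subst_ren_p s t u P :
  (forall k, fv_p k P -> exists2 y, s k = Var y & eq_neg (t y) (u k)) ->
  eq_pos (subst_p t (subst_p s P)) (subst_p u P)
with subst_ren_s s t u S :
  (forall k, fv_s k S -> exists2 y, s k = Var y & eq_neg (t y) (u k)) ->
  eq_pre (subst_s t (subst_s s S)) (subst_s u S)
with subst_ren_n s t u N :
  (forall k, fv_n k N -> exists2 y, s k = Var y & eq_neg (t y) (u k)) ->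
  eq_neg (subst_n t (subst_n s N)) (subst_n u N).
Proof.
- case: P => [|I F] es; rewrite !subst_pE; constructor=> i;
    by exists i; apply: subst_ren_s => k fk; apply: es; apply: fv_Conj fk.
- case: S => N0 a Ns es; rewrite !subst_sE.
  constructor=> [|j]; apply: subst_ren_n => // k fk; apply: es.
    exact: fv_head.
  by apply: (@fv_arg _ _ _ _ _ j).
- case: N => [x|B] es; rewrite !(subst_nE u, subst_nE s).
    by case: (es x) => [|y -> e]; [constructor | rewrite subst_nE].
  rewrite subst_nE; constructor=> a; apply: subst_ren_p => // k fk.
  rewrite /up; case: ltnP => ak.
    by exists k; rewrite // ak; apply: eq_neg_refl.
  case: (es (k - ar a)) => [|y -> e]; first exact: fv_SumB.
  exists (y + ar a); first by rewrite ren_nE.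
  by rewrite ltnNge leq_addl /= addnK; apply: eq_ren_n.
Qed.

Lemma subst_id_p s P : (forall k, fv_p k P -> s k = Var k) ->
  eq_pos (subst_p s P) P
with subst_id_s s S : (forall k, fv_s k S -> s k = Var k) ->
  eq_pre (subst_s s S) S
with subst_id_n s N : (forall k, fv_n k N -> s k = Var k) ->
  eq_neg (subst_n s N) N.
Proof.
- case: P => [|I F] es; rewrite !subst_pE; constructor=> i;
    by exists i; apply: subst_id_s => k fk; apply: es; apply: fv_Conj fk.
- case: S => N0 a Ns es; rewrite !subst_sE.
  constructor=> [|j]; apply: subst_id_n => // k fk; apply: es.
    exact: fv_head.
  by apply: (@fv_arg _ _ _ _ _ j).
- case: N => [x|B] es; rewrite !subst_nE.
    by rewrite es; [apply: eq_neg_refl | constructor].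
  constructor=> a; apply: subst_id_p => // k fk.
  rewrite /up; case: ltnP => // ak.
  by rewrite es ?ren_nE ?subnK //; apply: fv_SumB.
Qed.

Lemma subst_closed s N : (forall x, ~ fv_n x N) -> eq_neg (subst_n s N) N.
Proof. by move=> cN; apply: subst_id_n => k /cN. Qed.

(** * Renamings: free variables and standardness *)

Definition renaming s := forall k, exists y, s k = Var y.

Lemma renaming_up n s : renaming s -> renaming (up n s).
Proof.
move=> rs k; rewrite /up; case: ltnP => _; first by exists k.
by have [y ->] := rs (k - n); exists (y + n); rewrite ren_nE.
Qed.

Lemma fv_renaming_mut :
  (forall x Q, fv_p x Q -> forall s P, renaming s -> Q = subst_p s P ->
     exists2 y, fv_p y P & s y = Var x) /\
  (forall x S', fv_s x S' -> forall s S, renaming s -> S' = subst_s s S ->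
     exists2 y, fv_s y S & s y = Var x) /\
  (forall x N', fv_n x N' -> forall s N, renaming s -> N' = subst_n s N ->
     exists2 y, fv_n y N & s y = Var x).
Proof.
(* Equalities between [Conj]s or [Cut]s are exploited by rewriting in a predicate
   on the whole term; injectivity would only give an equality of dependent pairs. *)
apply: fv_mut.
- move=> x I F i _ IH s [|J G] rs; rewrite subst_pE // => e.
  have [j /= ej] : exists j : idx (Conj (fun j => subst_s s (G j))),
    conjunct j = F i by rewrite -e; exists i.
  have [y fy sy] := IH s (G j) rs (esym ej).
  by exists y => //; apply: fv_Conj fy.
- move=> x N0 a Ns _ IH s [N1 b Ms] rs; rewrite subst_sE => -[eN _ _].
  have [y fy sy] := IH s N1 rs eN.
  by exists y => //; apply: fv_head.
- move=> x N0 a Ns j _ IH s [N1 b Ms] rs; rewrite subst_sE => e.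
  pose has_arg S := let: Cut _ _ Ls := S in exists i, Ns j = Ls i.
  have [i ei] : has_arg (Cut (subst_n s N1) b (fun i => subst_n s (Ms i))).
    by rewrite -e; exists j.
  have [y fy sy] := IH s (Ms i) rs ei.
  by exists y => //; apply: fv_arg fy.
- move=> x s [y|B] rs; rewrite subst_nE // => e.
  by exists y; [constructor | rewrite e].
- move=> x B a _ IH s [z|C] rs; rewrite subst_nE => e.
    by have [y sz] := rs z; rewrite sz in e.
  have [y fy] : exists2 y, fv_p y (C a) & up (ar a) s y = Var (x + ar a).
    apply: IH; first exact: renaming_up.
    by have := congr1 (fun N => if N is Sum D then D a else Omega) e.
  (* An index bound by the component is fixed by [up], hence is not sent to [x + ar a], which is at
     least [ar a]. *)
  rewrite /up; case: ltnP => ay.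
    by case=> ey; move: ay; rewrite ey ltnNge leq_addl.
  have [z ez] := rs (y - ar a); rewrite ez ren_nE => -[/addIn zx].
  by exists (y - ar a); [apply: fv_SumB | rewrite ez zx].
Qed.

Lemma std_renaming_p s P : renaming s -> std_p P -> std_p (subst_p s P)
with std_renaming_s s S : renaming s -> std_s S -> std_s (subst_s s S)
with std_renaming_n s N : renaming s -> std_n N -> std_n (subst_n s N).
Proof.
- move=> rs; case=> [|I F sF]; rewrite subst_pE; constructor=> i.
  exact: std_renaming_s.
- move=> rs; case=> x a Ns sNs; rewrite subst_sE subst_nE.
  by case: (rs x) => y ->; constructor=> j; apply: std_renaming_n.
- move=> rs; case=> B sB; rewrite subst_nE; constructor=> a.
  by apply: std_renaming_p => //; apply: renaming_up.
Qed.

(** * Convergence as an inductive description of having normal form daimon *)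

Inductive converges P : Prop :=
| Converges : P <> Omega -> (forall i : idx P, is_redex (conjunct i)) ->
    (forall i : idx P, converges (contractum (conjunct i))) -> converges P.

Lemma converges_reds P Q : reds P Q -> converges P -> converges Q.
Proof.
by elim=> {P Q} [P|P Q R [i [_ ->]] _ IH [_ _ cP]]; [apply | apply/IH/cP].
Qed.

Lemma converges_defined P : converges P -> ~ undefined P.
Proof.
move=> cP [[f [f0 fred]]|PO]; last by case: (converges_reds PO cP).
elim: cP f f0 fred => {}P _ _ _ IH f f0 fred.
have := fred 0; rewrite f0 => -[i [_ e]].
exact: (IH i (fun k => f k.+1)).
Qed.

Lemma converges_headless P : converges P -> path_to_head P -> False.
Proof.
move=> cP h; elim: h cP => {P} [P i nr [_ rP _]|P i _ _ IH [_ _ cP]].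
  by rewrite rP in nr.
exact/IH/cP.
Qed.

Lemma red_undefined P Q : red P Q -> undefined Q -> undefined P.
Proof.
move=> PQ [[f [f0 fred]]|QO]; last by right; apply: reds_step QO.
left; exists (fun k => if k is k'.+1 then f k' else P).
by split=> // -[|k] //; rewrite f0.
Qed.

(** By contradiction: a defined, headless design that does not converge has a reduct of the same
    kind, and iterating a choice of such reducts yields an infinite reduction. *)
Lemma defined_headless_converges P :
  ~ undefined P -> (path_to_head P -> False) -> converges P.
Proof.
move=> dP hP; apply: NNPP => ncP.
pose bad Q := [/\ ~ undefined Q, path_to_head Q -> False & ~ converges Q].
have bad_red Q : bad Q -> exists Q', red Q Q' /\ bad Q'.
  case=> dQ hQ ncQ; apply: NNPP => nQ; apply: ncQ.
  have rQ (i : idx Q) : is_redex (conjunct i).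
    by apply: contraT => nr; case: hQ; exact: Stop nr.
  split=> [QO||i]; [by apply: dQ; right; rewrite QO; constructor | exact: rQ |].
  apply: NNPP => nci; apply: nQ; exists (contractum (conjunct i)).
  have Qi : red Q (contractum (conjunct i)) by exists i.
  split=> //; split=> // [/(red_undefined Qi)//|h].
  exact: hQ (Step (rQ i) h).
pose next Q := epsilon (inhabits Q) (fun Q' => red Q Q' /\ bad Q').
have nextP Q : bad Q -> red Q (next Q) /\ bad (next Q).
  by move=> /bad_red; apply: epsilon_spec.
have bad_iter k : bad (iter k next P) by elim: k => [|k /nextP[]].
apply: dP; left; exists (fun k => iter k next P); split=> // k.
by have /nextP[] := bad_iter k.
Qed.

Lemma nf_daimonP P : eq_pos (nf_p P) (daimon Sg) <-> converges P.
Proof.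
have eq_daimon Q : eq_pos Q (daimon Sg) <-> Q <> Omega /\ (idx Q -> False).
  split.
    (* The right-hand side becomes a variable so that case analysis on [eq_pos] meets no dependent
       equality. *)
    suff gen R : eq_pos Q R -> R <> Omega -> (idx R -> False) ->
      Q <> Omega /\ (idx Q -> False) by move=> e; apply: gen e _ _ => // -[].
    by case=> // I J F G FG _ _ nJ; split=> // i; case: (FG i) => j _.
  by case: Q => [[]|I F [_ nI]] //; constructor=> [i|[]]; case: (nI i).
rewrite eq_daimon nf_pE; case: excluded_middle_informative => dP /=.
  by split=> [[]|/converges_defined].
split=> [[_ hP]|cP]; first exact: defined_headless_converges.
by split=> // h; apply: converges_headless h.
Qed.

Lemma eq_neg_bound n (K K' : 'I_n -> negative) k :
  (forall j, eq_neg (K j) (K' j)) ->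
  eq_neg (bound_subst K k) (bound_subst K' k).
Proof.
by move=> eK; rewrite /bound_subst; case: insub => [j|]; [apply: eK | constructor].
Qed.

Lemma eq_pre_redex S S' : eq_pre S S' -> is_redex S ->
  is_redex S' /\ eq_pos (contractum S) (contractum S').
Proof.
case=> _ _ a Ns Ns' [//|B B' eB] eNs _; split=> //=.
by apply: eq_subst_p => // k _; apply: eq_neg_bound.
Qed.

(** Each conjunct of [Q] equals some conjunct of [P], and equal redexes have equal contracta, so the
    derivation for [P] can be followed. *)
Lemma converges_eq P Q : eq_pos P Q -> converges P -> converges Q.
Proof.
move=> eq cP; elim: cP Q eq => {}P nP rP _ IH Q eq.
case: eq nP rP IH => [/(_ erefl) []|I J F G _ GF _ rF IH].
split=> [//|j|j] /=;
  have [i /eq_pre_redex/(_ (rF i))[rG eFG]] := GF j; first exact: rG.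
exact: IH eFG.
Qed.

Lemma converges_eqE P Q : eq_pos P Q -> converges P <-> converges Q.
Proof.
by move=> e; split; apply: converges_eq; [|apply: eq_pos_sym].
Qed.

(** * Orthogonality to generators and bodies with named variables *)

Lemma named_substE n (y : n.-tuple nat) (K : 'I_n -> negative) j :
  uniq y -> named_subst y K (tnth y j) = K j.
Proof.
move=> uy; rewrite /named_subst; case: pickP => [i /eqP e|/(_ j)].
  by congr K; apply/(tuple_uniqP _ uy).
by rewrite eqxx.
Qed.

Lemma named_subst1E (x : nat) N : named_subst [tuple x] (fun=> N) x = N.
Proof. exact: (@named_substE 1 [tuple x] _ ord0). Qed.

Lemma orth_generator (B : name Sg -> positive) a (K : 'I_(ar a) -> negative) :
  (forall j x, ~ fv_n x (K j)) ->
  orth (of_predesign (Cut (Var x0) a K)) (Sum B) <->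
  converges (subst_p (bound_subst K) (B a)).
Proof.
move=> cK; rewrite /orth nf_daimonP subst_of_predesign subst_sE subst_nE.
rewrite named_subst1E.
set s := named_subst _ _.
(* The substitution for [x0] also enters the arguments [K j]; these are closed, so they stay the
   same up to [eq_neg]. *)
have e : eq_pos (subst_p (bound_subst (fun j => subst_n s (K j))) (B a))
                (subst_p (bound_subst K) (B a)).
  apply: eq_subst_p => [|k _]; first exact: eq_pos_refl.
  by apply: eq_neg_bound => j; apply: subst_closed.
by rewrite -(converges_eqE e); split=> [[_ _ /(_ tt)]|c]; [apply | split=> [||[]]].
Qed.

Lemma bound_subst_var n (y : n.-tuple nat) :
  renaming (bound_subst (fun j => Var (tnth y j))).
Proof. by move=> k; rewrite /bound_subst; case: insub => [j|]; eexists. Qed.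

Lemma bound_substE n (K : 'I_n -> negative) (j : 'I_n) :
  bound_subst K j = K j.
Proof. by rewrite /bound_subst valK. Qed.

(** Naming the bound variables and then filling the names amounts to filling the binder: distinct
    names determine their positions, and [P] has no other free variable. *)
Lemma converges_body a (y : (ar a).-tuple nat) K P :
  uniq y -> (forall k, fv_p k P -> k < ar a) ->
  converges (subst_p (named_subst y K) (body_with y P)) <->
  converges (subst_p (bound_subst K) P).
Proof.
move=> uy fvP; apply/converges_eqE/subst_ren_p => k /fvP ka.
rewrite (_ : k = Ordinal ka) // !bound_substE.
by eexists; rewrite // named_substE //; apply: eq_neg_refl.
Qed.

Lemma fv_body a (y : (ar a).-tuple nat) P :
  (forall k, fv_p k P -> k < ar a) ->
  forall x, fv_p x (body_with y P) -> x \in y.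
Proof.
move=> fvP x fx.
have [k /fvP ka] := fv_renaming_mut.1 _ _ fx _ _ (bound_subst_var y) erefl.
rewrite (_ : k = Ordinal ka) // bound_substE => -[<-].
exact: mem_tnth.
Qed.

Lemma fv_component (B : name Sg -> positive) a k :
  atomic_n (Sum B) -> fv_p k (B a) -> k < ar a.
Proof. by case=> _ cB fk; case: ltnP => // /(fv_SumB fk) /cB. Qed.

Lemma std_component (B : name Sg -> positive) a :
  std_n (Sum B) -> std_p (B a).
Proof.
(* The default [Omega] is never reached, as a standard negative design is a [Sum]. *)
suff gen N : std_n N -> forall a, std_p (if N is Sum C then C a else Omega).
  by move=> sB; apply: (gen _ sB).
by case.
Qed.

(** * The negative daimon and its membership in duals of behaviours *)

Definition neg_daimon : negative := Sum (fun=> daimon Sg).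

Lemma atomic_neg_daimon : atomic_n neg_daimon.
Proof.
split=> [|x]; first by constructor=> a; constructor=> -[].
have fv0 k P : fv_p k P -> P <> daimon Sg.
  by case=> {k P} k I F i _ e; have : idx (daimon Sg) by rewrite -e; exact: i.
suff gen N : fv_n x N -> N <> neg_daimon by move=> /gen.
by case=> {x N} // x B a /fv0 fB [eB]; apply: fB; rewrite eB.
Qed.

(** All heads of an atomic positive design are [x0], so after substitution every conjunct is a cut
    on [neg_daimon], which reduces to the daimon in one step. *)
Lemma orth_neg_daimon P : atomic_p P -> orth P neg_daimon.
Proof.
case=> -[nP sP] fP; apply/nf_daimonP.
case: sP nP fP => [[]//|I F sF _ fP]; rewrite subst_pE.
have cut i : exists a (K : 'I_(ar a) -> negative), F i = Cut (Var x0) a K.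
  have fi x : fv_s x (F i) -> x = x0 by move=> fx; apply/fP/fv_Conj/fx.
  case: (sF i) fi => x a K _ fi; exists a, K; rewrite (fi x) //.
  by apply: fv_head; constructor.
have {cut} cut i : exists a K, subst_s (named_subst [tuple x0] (fun=> neg_daimon)) (F i)
    = Cut neg_daimon a K.
  have [a [K ->]] := cut i; rewrite subst_sE subst_nE named_subst1E.
  by exists a; eexists.
split=> [//|i|i]; have [a [K e]] := cut i;
  have {}e : conjunct i = Cut neg_daimon a K := e; rewrite e; first by [].
by rewrite [contractum _]subst_pE; split=> [|[]|[]].
Qed.

(** Being its own bidual, a positive behaviour contains only atomic designs. *)
Lemma dual_neg_daimon (X : positive -> Prop) :
  positive_behaviour X -> dual_p X neg_daimon.
Proof.
move=> bX; split=> [|P /bX[aP _]]; first exact: atomic_neg_daimon.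
exact: orth_neg_daimon.
Qed.

(** * Invariance of orthogonality and atomicity of generators *)

Lemma orth_eq P Q N : eq_pos P Q -> orth P N -> orth Q N.
Proof.
move=> e /nf_daimonP cP; apply/nf_daimonP; apply: converges_eq cP.
by apply: eq_subst_p => // k _; apply: eq_neg_refl.
Qed.

Lemma fv_generator a (K : 'I_(ar a) -> negative) x :
  (forall j x, ~ fv_n x (K j)) ->
  fv_p x (of_predesign (Cut (Var x0) a K)) -> x = x0.
Proof.
move=> cK fx.
(* These inversions speak of the whole term, which avoids equalities of dependent pairs. *)
have inv_p P : fv_p x P -> exists i : idx P, fv_s x (conjunct i).
  by case=> {P} y I F i fi; exists i.
have inv_s S : fv_s x S ->
    let: Cut N _ Ns := S in fv_n x N \/ exists j, fv_n x (Ns j).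
  by case=> {S} y N b Ns; [left | right; exists j].
have inv_n N : fv_n x N -> if N is Var y then x = y else True by case.
by have [[] /inv_s [/inv_n|[j /cK]]] := inv_p _ fx.
Qed.

Lemma atomic_generator a (K : 'I_(ar a) -> negative) :
  (forall j, atomic_n (K j)) -> atomic_p (of_predesign (Cut (Var x0) a K)).
Proof.
move=> aK; split=> [|x]; last by apply: fv_generator => j; case: (aK j).
by split=> //; constructor=> _; constructor=> j; case: (aK j).
Qed.

End Theory.

Theorem theorem2p17 (Sg : signature) (n : nat) (alpha : connective Sg n)
    (Ps : 'I_n -> positive Sg -> Prop)
    (hPs : forall k : 'I_n, positive_behaviour (Ps k))
    (P : name Sg -> positive Sg) (hN : atomic_n (Sum P)) :
  connective_neg alpha Ps (Sum P) <->
  (forall s : action Sg, List.In s (cacts alpha) ->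
   forall i : 'I_(ar (aname s)) -> 'I_n,
     indexed_by (cvars alpha) (avars s) i ->
     models (body_with (avars s) (P (aname s))) (avars s) (fun j => Ps (i j))).
Proof.
have fvP a k : fv_p k (P a) -> k < ar a by apply: fv_component.
have closed m (Qs : 'I_m -> positive Sg -> Prop) (K : 'I_m -> negative Sg) :
  (forall j, dual_p (Qs j) (K j)) -> forall j x, ~ fv_n x (K j).
  by move=> dK j; case: (dK j) => -[_ cK] _.
split=> [[_ orthN] s s_in i si|modN].
  have uy := avars_uniq s_in.
  have bodyP (K : 'I_(ar (aname s)) -> negative Sg) :
      (forall j, dual_p (Ps (i j)) (K j)) ->
      converges (subst_p (named_subst (avars s) K)
        (body_with (avars s) (P (aname s)))).
    move=> dK; apply/(converges_body K uy (@fvP _)).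
    (* The generator lies in the bidual: it is atomic, and orthogonal by definition to everything in
       the dual of the generators. *)
    apply/(orth_generator P (closed _ _ _ dK))/orthN; split.
      by apply: atomic_generator => j; case: (dK j).
    move=> N [_]; apply; exists s => //; exists i => //.
    by exists K => //; apply: eq_pos_refl.
  split=> [|x|K /bodyP/nf_daimonP //]; last exact: (fv_body (@fvP _)).
  split; last first.
    apply: std_renaming_p; first exact: bound_subst_var.
    by case: hN => sN _; apply: std_component.
  (* Were the body [Omega], filling it with negative daimons would give [Omega] again, which does
     not converge. *)
  move=> bodyO; have := bodyP _ (fun j => dual_neg_daimon (hPs (i j))).
  by rewrite bodyO subst_pE; case.
(* Any [Q] in the bidual is orthogonal to whatever lies in the dual of the generators, so only a
   generator [R] remains to be tested. *)
split=> // Q [_]; apply; split=> // R [s s_in [i si [K dK eR]]].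
apply: (orth_eq (eq_pos_sym eR)).
apply/(orth_generator P (closed _ _ _ dK)).
apply/(converges_body K (avars_uniq s_in) (@fvP _))/nf_daimonP.
by case: (modN s s_in i si) => _ _; apply.
Qed.
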